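(* Let $\mathcal{F}$ be a family of $2$-element subsets of a finite set $[n]$, and let $G=K(\mathcal{F})$. Then $\overline{\xi}_l(G,\mathbb{R})=\chi(G)$. Equivalently, for every graph $G$ that is the complement of a line graph, $\overline{\xi}_l(G,\mathbb{R})=\chi(G)$.
   Context: For a set system $\mathcal{F}$, $K(\mathcal{F})$ is the graph with vertex set $\mathcal{F}$ in which distinct $A,B\in\mathcal{F}$ are adjacent iff $A\cap B=\emptyset$. For a vertex $v$, $N(v)$ is its set of neighbors. For $x,y\in\mathbb{R}^t$, $\langle x,y\rangle=\sum_i x_iy_i$. An orthogonal representation of $G=(V,E)$ over a field $\mathbb{F}$ assigns $u_v\in\mathbb{F}^t$ to every $v\in V$ with $\langle u_v,u_v\rangle\neq0$ and $\langle u_v,u_{v'}\rangle=0$ for adjacent $v,v'$. Its locality is $\max_{v}\dim\mathrm{span}\{u_{v'}: v'\in\{v\}\cup N(v)\}$, and $\overline{\xi}_l(G,\mathbb{F})$ is the minimum locality of an orthogonal representation of $G$ over $\mathbb{F}$. $\chi(G)$ is the chromatic number. *)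

(* Defs.v *)
From HB Require Import structures.
From mathcomp Require Import all_boot all_order all_algebra.
From mathcomp Require Import boolp.
Set Implicit Arguments. Unset Strict Implicit. Unset Printing Implicit Defensive.
Import Order.TTheory GRing.Theory Num.Theory.
Local Open Scope ring_scope.

Definition dotv (K : fieldType) (t : nat) (x y : 'rV[K]_t) : K :=
  \sum_(i < t) x 0 i * y 0 i.

Definition orth_rep (K : fieldType) (V : finType) (adj : rel V) (t : nat)
    (u : V -> 'rV[K]_t) : Prop :=
  (forall v, dotv (u v) (u v) != 0) /\
  (forall v w, v != w -> adj v w -> dotv (u v) (u w) = 0).

Definition locality (K : fieldType) (V : finType) (adj : rel V) (t : nat)
    (u : V -> 'rV[K]_t) : nat :=
  \max_(v : V) \rank (\sum_(w : V | (w == v) || adj v w) <<u w>>)%MS.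

Lemma orth_rep_exists (K : fieldType) (V : finType) (adj : rel V) :
  exists k : nat, `[< exists t (u : V -> 'rV[K]_t),
                       orth_rep adj u /\ locality adj u = k >].
Proof.
set u := fun v : V => (delta_mx 0 (enum_rank v) : 'rV[K]_#|V|).
have du : forall a b, dotv (u a) (u b) = (a == b)%:R.
  move=> a b; rewrite /dotv (bigD1 (enum_rank a)) //= big1 => [|i Hi].
    rewrite !mxE !eqxx /= (inj_eq enum_rank_inj) mul1r addr0.
    by case: (a == b).
  by rewrite !mxE eqxx /= (negbTE Hi) mul0r.
exists (locality adj u); apply/asboolP; exists #|V|, u; split => //; split.
  by move=> v; rewrite du eqxx oner_neq0.
by move=> v w /negbTE Hvw _; rewrite du Hvw.
Qed.

Definition xi_l_bar (K : fieldType) (V : finType) (adj : rel V) : nat :=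
  ex_minn (orth_rep_exists K adj).

Definition colorable (V : finType) (adj : rel V) (k : nat) : bool :=
  [exists f : {ffun V -> 'I_k}, [forall x, forall y, adj x y ==> (f x != f y)]].

Lemma colorable_exists (V : finType) (adj : rel V) :
  (forall x, ~~ adj x x) -> exists k, colorable adj k.
Proof.
move=> irr; exists #|V|; apply/existsP; exists [ffun x => enum_rank x].
apply/forallP => x; apply/forallP => y; apply/implyP => Hxy.
rewrite !ffunE (inj_eq enum_rank_inj); apply/eqP => E; subst.
by rewrite (negbTE (irr y)) in Hxy.
Qed.

Definition Kvert (n : nat) (F : {set {set 'I_n}}) := {A : {set 'I_n} | A \in F}.
Definition Kadj (n : nat) (F : {set {set 'I_n}}) : rel (Kvert F) :=
  fun A B => (A != B) && (val A :&: val B == set0).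

Lemma Kadj_irr (n : nat) (F : {set {set 'I_n}}) : forall x, ~~ @Kadj n F x x.
Proof. by move=> x; rewrite /Kadj eqxx. Qed.

Definition chiK (n : nat) (F : {set {set 'I_n}}) : nat :=
  ex_minn (colorable_exists (@Kadj_irr n F)).

(* Main.v *)
(* View the family as the edge set E of a graph; colour classes are intersecting
   families of edges (sub-stars and triangles). For a vertex set X let r(E - X)
   be the rank of the vectors of the edges avoiding X. If the locality is at most
   d then r(E - {x,y}) < d for every edge xy, and we show by induction on |E| that
   d colours suffice; the induction also colours any proper subset E' of E with
   r(E') colours.
     Suppose d colours do not suffice. Then every path of E on a vertex set X with
   at least two vertices satisfies r(E - X) <= d + 1 - |X|. Otherwise take a
   shortest exception X: deleting an end x of the path gives
   r(E - (X - x)) = r(E - X), hence equal spans, so the edges meeting X in x only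
   lie in the span of E - X, of rank d + 2 - |X|. If the two ends of X are not
   adjacent, the stars at the |X| - 2 inner vertices leave only such edges. If
   they are adjacent, X is a cycle, so that three consecutive vertices x, y, z of
   it are ends of Hamiltonian paths of X: use the |X| - 3 other stars and the
   triangle xyz. Either way d colours suffice after all.
     Finally let X be a longest path. All the neighbours of one end x lie in X,
   so the stars at X - x leave only edges avoiding X, and E is coloured with
   |X| - 1 + r(E - X) <= d colours. *)
Require Import Defs.
From mathcomp Require Import all_boot all_order all_algebra.
From mathcomp Require Import reals.
From mathcomp Require Import boolp zify.
Set Implicit Arguments. Unset Strict Implicit. Unset Printing Implicit Defensive.
Import Order.TTheory GRing.Theory Num.Theory.

Lemma disjoint_rcons (T : finType) (s : seq T) x (B : {set T}) :
  [disjoint rcons s x & B] = (x \notin B) && [disjoint s & B].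
Proof. by rewrite !disjoint_has -!all_predC all_rcons. Qed.

Lemma disjoint_set2 (T : finType) x y (B : {set T}) :
  [disjoint [set x; y] & B] = (x \notin B) && (y \notin B).
Proof. by rewrite disjoints_subset subUset !sub1set !inE. Qed.

(** * Covers by intersecting families *)

Section Covers.
Variable T : finType.
Implicit Types (E : {set {set T}}) (e f : {set T}) (s : seq T) (k : nat).

Definition int_cover E k : Prop :=
  exists c : {set T} -> nat, {in E, forall e, c e < k} /\
    {in E &, forall e f, [disjoint e & f] -> c e <> c f}.

Definition avoid E s : {set {set T}} := [set e in E | [disjoint s & e]].

Lemma avoid_sub E s : avoid E s \subset E.
Proof. by apply/subsetP => e; rewrite inE => /andP[]. Qed.

Lemma avoid_cons E x s : avoid E (x :: s) = [set e in avoid E s | x \notin e].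
Proof. by apply/setP => e; rewrite !inE disjoint_cons -andbA [_ && (x \notin e)]andbC. Qed.

Lemma avoidS E s s' : {subset s <= s'} -> avoid E s' \subset avoid E s.
Proof.
move=> sub; apply/subsetP => e; rewrite !inE => /andP[-> /=].
by apply: disjointWl; apply/subsetP.
Qed.

Lemma int_coverW E k k' : k <= k' -> int_cover E k -> int_cover E k'.
Proof.
by move=> le_kk' [c [c_lt c_neq]]; exists c; split=> // e /c_lt/leq_trans; apply.
Qed.

Lemma int_coverU1 E (I : pred {set T}) k :
    {in E &, forall e f, I e -> I f -> ~~ [disjoint e & f]} ->
  int_cover [set e in E | ~~ I e] k -> int_cover E k.+1.
Proof.
move=> I_int [c [c_lt c_neq]].
exists (fun e => if I e then k else c e); split=> [e eE | e f eE fE dis].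
  case: ifP => // nIe; apply: leqW.
  by apply: c_lt; rewrite inE eE nIe.
have [Ie|nIe] := boolP (I e); have [If|nIf] := boolP (I f).
- by have := I_int e f eE fE Ie If; rewrite dis.
- have : c f < k by apply: c_lt; rewrite inE fE nIf.
  by move=> + kE; rewrite -kE ltnn.
- have : c e < k by apply: c_lt; rewrite inE eE nIe.
  by move=> + kE; rewrite kE ltnn.
- by apply: c_neq; rewrite ?inE ?eE ?fE ?nIe ?nIf.
Qed.

(** Each vertex of [s] costs one class, the star of edges through it. *)
Lemma int_cover_avoid E s k :
  int_cover (avoid E s) k -> int_cover E (k + size s).
Proof.
elim: s k => [|x s IHs] k /=.
  rewrite addn0; suff -> : avoid E [::] = E by [].
  by apply/setP => e; rewrite !inE disjoint_has /= andbT.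
rewrite avoid_cons -addSnnS => cov; apply: IHs.
apply: (int_coverU1 (I := fun e => x \in e)) => // e f _ _ xe xf.
by apply/pred0Pn; exists x; rewrite /= xe.
Qed.

End Covers.

(** * Ranks of spans of edge vectors *)

Section Representation.
Variables (T : finType) (K : fieldType) (t : nat) (u : {set T} -> 'rV[K]_t).
Implicit Types (E : {set {set T}}) (s p : seq T) (d : nat).

Definition span E := (\sum_(e in E) <<u e>>)%MS.

Lemma spanP E m (A : 'M[K]_(m, t)) :
  reflect {in E, forall e, (u e <= A)%MS} (span E <= A)%MS.
Proof.
apply: (iffP sumsmx_subP) => H e /H; by rewrite genmxE.
Qed.

Lemma mem_span E e : e \in E -> (u e <= span E)%MS.
Proof. by move: e; apply/spanP. Qed.

Lemma spanS E E' : E \subset E' -> (span E <= span E')%MS.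
Proof. by move=> /subsetP sub; apply/spanP => e /sub; apply: mem_span. Qed.

Lemma dotvE (x y : 'rV[K]_t) : dotv x y = ((x *m y^T) 0 0)%R.
Proof. by rewrite !mxE; apply: eq_bigr => i _; rewrite !mxE. Qed.

(** All of [span E] is orthogonal to [w], but [w] is not orthogonal to itself. *)
Lemma rank_span_orth E (w : 'rV[K]_t) :
    (dotv w w != 0)%R -> {in E, forall e, dotv (u e) w = 0%R} ->
  \rank (span E) < \rank (span E + <<w>>)%MS.
Proof.
move=> ww0 orth; rewrite ltn_neqAle mxrankS ?addsmxSl // andbT.
apply: contra ww0; rewrite (mxrank_leqif_sup (addsmxSl _ _)).
rewrite addsmx_sub submx_refl /= genmxE => w_span.
have /sub_kermxP w0 : (w <= kermx (w^T)%R)%MS.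
  apply: submx_trans w_span _; apply/spanP => e /orth we0.
  by apply/sub_kermxP/matrixP => i j; rewrite !ord1 -dotvE we0 mxE.
by rewrite dotvE w0 mxE.
Qed.

(** The bound r(E - X) <= d + 1 - |X|, kept additive to avoid truncated subtraction. *)
Definition low E d s := \rank (span (avoid E s)) + size s <= d.+1.

(** The two bounds squeeze the ranks of the nested spans of [avoid E s] and [avoid E s'] to
    equality. *)
Lemma low_deletion E d s s' f :
    ~~ low E d s -> low E d s' -> size s = (size s').+1 ->
    {subset s' <= s} -> f \in avoid E s' ->
  (u f <= span (avoid E s))%MS.
Proof.
rewrite /low -ltnNge => ns ls' sz sub fE.
have le_span := spanS (avoidS E sub).
suff : (span (avoid E s') <= span (avoid E s))%MS.
  exact: submx_trans (mem_span fE).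
rewrite -(mxrank_leqif_sup le_span) eqn_leq mxrankS //=.
by move: ns ls'; rewrite sz; lia.
Qed.

(** * Paths in a minimal counterexample *)

Section Step.
Variables (E : {set {set T}}) (d : nat).
Hypothesis card2 : {in E, forall e : {set T}, #|e| = 2}.
Hypothesis edge_rank :
  forall x y, [set x; y] \in E -> \rank (span (avoid E [:: x; y])) < d.
Hypothesis cover_sub :
  forall E', E' \proper E -> int_cover E' (\rank (span E')).
Hypothesis not_cover : ~ int_cover E d.

Let adj x y := [set x; y] \in E.

Lemma edge_set x y f : f \in E -> x != y -> x \in f -> y \in f -> f = [set x; y].
Proof.
move=> fE xy xf yf; apply/esym/eqP.
by rewrite eqEcard subUset !sub1set xf yf cards2 xy card2.
Qed.

(* The colouring of E' extends to E at the cost of k new intersecting classes;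
   s0 is any one of the low deletions of s, needed in case E' is empty. *)
Lemma low_of_deletions s s0 E' k :
    low E d s0 -> size s = (size s0).+1 -> {subset s0 <= s} ->
    E' \proper E ->
    (forall f, f \in E' -> exists s', [/\ low E d s', size s = (size s').+1,
       {subset s' <= s} & f \in avoid E s']) ->
    (forall m, int_cover E' m -> int_cover E (m + k)) -> k.+2 <= size s ->
  low E d s.
Proof.
move=> ls0 sz0 sub0 prop dels extend szk; apply/idPn => ns; apply: not_cover.
have /mxrankS r1 : (span E' <= span (avoid E s))%MS.
  apply/spanP => f /dels[s' [ls' sz' sub' fE]].
  exact: low_deletion ns ls' sz' sub' fE.
have r2 := mxrankS (spanS (avoidS E sub0)).
(* Here r(E') <= d + 2 - |s| by monotonicity, and k <= |s| - 2. *)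
have := extend _ (cover_sub prop); apply: int_coverW.
by move: ls0 sz0 r1 r2 szk ns; rewrite /low; lia.
Qed.

Lemma path_low s : sorted adj s -> uniq s -> 1 < size s -> low E d s.
Proof.
have [m] := ubnP (size s); elim: m s => // m IHm [//|x [//|y p]].
case: (lastP p) => [_ /=|q z].
  by rewrite andbT => /edge_rank; rewrite /low /= addn2.
rewrite ltnS => lt_m s_path s_uniq _.
have [xy yp_path] : adj x y /\ path adj y (rcons q z) by apply/andP.
have sz0 : size [:: x, y & rcons q z] = (size (y :: rcons q z)).+1 by [].
have sz1 : size [:: x, y & rcons q z] = (size [:: x, y & q]).+1.
  by rewrite /= size_rcons.
have sub0 : {subset y :: rcons q z <= [:: x, y & rcons q z]}.
  by move=> v; rewrite [v \in x :: _]inE orbC => ->.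
have sub1 : {subset [:: x, y & q] <= [:: x, y & rcons q z]}.
  by move=> v; rewrite !inE mem_rcons inE => /or3P[->|->|->]; rewrite ?orbT.
have xz : x != z.
  by apply: contraTneq s_uniq => <-; rewrite /= inE mem_rcons inE eqxx orbT.
have low0 : low E d (y :: rcons q z).
  apply: IHm => //; first by case/andP: s_uniq.
  by rewrite /= size_rcons.
have low1 : low E d [:: x, y & q].
  apply: IHm => //.
  + by rewrite -ltnS -sz1.
  + by move: s_path; rewrite /= rcons_path => /and3P[-> ->].
  + by move: s_uniq; rewrite -!rcons_cons rcons_uniq => /andP[].
(* If the ends are not adjacent, an edge avoiding [y :: q] misses [x] or [z], so it survives in one
   of the two deletions. *)
have [zx|nzx] := boolP (adj z x); last first.
  apply: (low_of_deletions (E' := avoid E (y :: q)) (k := size (y :: q)) low0) => //.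
  - rewrite properE avoid_sub; apply/subsetPn; exists [set x; y] => //.
    by rewrite inE disjoint_cons !inE eqxx orbT andbF.
  - move=> f; rewrite inE => /andP[fE dis].
    have [zf|nzf] := boolP (z \in f); last first.
      exists (y :: rcons q z); split=> //; rewrite inE fE /=.
      move: dis; rewrite !disjoint_cons => /andP[-> /=].
      by rewrite disjoint_rcons nzf.
    have [xf|nxf] := boolP (x \in f).
      by move: nzx; rewrite /adj -(edge_set fE _ zf xf) ?fE // eq_sym.
    by exists [:: x, y & q]; split=> //; rewrite inE fE /= disjoint_cons nxf.
  - by move=> k; apply: int_cover_avoid.
  - by rewrite /= size_rcons.
(* The closing edge [zx] makes the deletion of [y] a path as well. *)
have low2 : low E d (rcons (rcons q z) x).
  apply: IHm.
  + by move: lt_m; rewrite /= !size_rcons.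
  + case: (q) yp_path => [|a r] /=; first by rewrite zx.
    by move=> /andP[_ ar_path]; rewrite rcons_path ar_path /= last_rcons.
  + case/and3P: s_uniq => + _ q_uniq; rewrite inE negb_or => /andP[_ xq].
    by rewrite rcons_uniq xq.
  + by rewrite !size_rcons.
pose tri := [set x; y; z].
(* An edge of this [E'] has at most one vertex in [tri], so it avoids one of the three deletions.
   The extra class in [k] holds the edges inside [tri]. *)
apply: (low_of_deletions (E' := [set f in avoid E q | ~~ (f \subset tri)])
         (k := (size q).+1) low0) => //.
- rewrite properE; apply/andP; split.
    by apply: subset_trans (avoid_sub E q); apply/subsetP => f; rewrite inE => /andP[].
  apply/subsetPn; exists [set x; y] => //.
  by rewrite inE subUset !sub1set !inE !eqxx !orbT andbF.
- move=> f; rewrite !inE => /andP[/andP[fE dis] ntri].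
  have two v w : v \in tri -> w \in tri -> v != w -> v \in f -> w \notin f.
    move=> vt wt vw vf; apply: contra ntri => wf.
    by rewrite (edge_set fE vw vf wf) subUset !sub1set vt.
  have [xt yt zt] : [/\ x \in tri, y \in tri & z \in tri].
    by rewrite !inE !eqxx !orbT.
  have yz : y != z.
    by apply: contraTneq s_uniq => <-; rewrite /= mem_rcons inE eqxx andbF.
  have xy' : x != y.
    by apply: contraTneq s_uniq => <-; rewrite /= !inE eqxx.
  have [xf|nxf] := boolP (x \in f).
    exists (y :: rcons q z); split=> //; rewrite inE fE disjoint_cons.
    by rewrite (two x y) //= disjoint_rcons (two x z).
  have [yf|nyf] := boolP (y \in f).
    exists (rcons (rcons q z) x); split=> //; first by rewrite /= !size_rcons.
      by move=> v; rewrite mem_rcons !inE => /predU1P[->|->]; rewrite ?eqxx ?orbT.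
    by rewrite inE fE !disjoint_rcons nxf (two y z).
  by exists [:: x, y & q]; split=> //; rewrite inE fE !disjoint_cons nxf nyf.
- move=> k cov; rewrite addnS -addSn; apply: int_cover_avoid.
  apply: int_coverU1 cov => e f eE fE et ft.
  have [eF fF] := (subsetP (avoid_sub E q) _ eE, subsetP (avoid_sub E q) _ fE).
  apply/negP => dis.
  have : #|e :|: f| <= #|tri| by rewrite subset_leq_card // subUset et.
  rewrite cardsU disjoint_setI0 // cards0 (card2 eF) (card2 fF) /tri -setUA !cardsU1 cards1.
  by case: (_ \notin _); case: (_ \notin _).
- by rewrite /= size_rcons.
Qed.

(** Otherwise edges avoiding [s] also avoid [x]; [path_low] on [x :: s] bounds their rank by d -
    |s|, and the stars at [s] complete a cover by [d] classes. *)
Lemma path_extend x s :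
    sorted adj (x :: s) -> uniq (x :: s) -> 0 < size s ->
  exists2 y, adj y x & y \notin x :: s.
Proof.
move=> s_path s_uniq s0.
have [/existsP[y /andP[]]|ext] := boolP [exists y, adj y x && (y \notin x :: s)].
  by exists y.
have avoid_x : avoid E s \subset avoid E (x :: s).
  apply/subsetP => f; rewrite avoid_cons !inE => fEs; rewrite fEs /=.
  move: fEs => /andP[fE dis]; apply: contra ext => xf.
  have [y yf] : exists y, y \in f :\ x.
    apply/set0Pn; rewrite -card_gt0; have := cardsD1 x f.
    by rewrite xf (card2 fE); case: #|_|.
  move: yf; rewrite !inE => /andP[yx yf]; apply/existsP; exists y.
  rewrite /adj -(edge_set fE yx yf xf) fE inE negb_or yx /=.
  by apply/negP => ys; have := disjointFr dis ys; rewrite yf.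
have := path_low s_path s_uniq s0; rewrite /low => low_s.
case: not_cover.
have prop : avoid E s \proper E.
  case: s s_path {s_uniq ext avoid_x low_s} s0 => // z r /= /andP[xz _] _.
  rewrite properE avoid_sub; apply/subsetPn; exists [set x; z] => //.
  by rewrite inE disjoint_cons !inE eqxx orbT andbF.
have := int_cover_avoid (cover_sub prop); apply: int_coverW.
have := mxrankS (spanS avoid_x).
by move: low_s => /=; lia.
Qed.

(** Repeated extension would outgrow [T]. *)
Lemma no_path s : sorted adj s -> uniq s -> 1 < size s -> False.
Proof.
have [m] := ubnP (#|T| - size s); elim: m s => // m IHm [//|x s].
move=> lt_m s_path s_uniq s_size.
have [y yx ys] := path_extend s_path s_uniq s_size.
have s'_uniq : uniq [:: y, x & s] by rewrite cons_uniq ys.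
have := max_card [in [:: y, x & s]]; rewrite (card_uniqP s'_uniq) /= => szT.
apply: (IHm [:: y, x & s]) => //=; first by move: lt_m => /=; lia.
by rewrite yx.
Qed.

End Step.

Lemma int_cover_edge_rank E d :
    {in E, forall e : {set T}, #|e| = 2} ->
    {in E, forall e, dotv (u e) (u e) != 0%R} ->
    {in E &, forall e f : {set T}, [disjoint e & f] -> dotv (u e) (u f) = 0%R} ->
    (forall x y, [set x; y] \in E -> \rank (span (avoid E [:: x; y])) < d) ->
  int_cover E d.
Proof.
have [m] := ubnP #|E|; elim: m E d => // m IHm E d.
rewrite ltnS => lt_m card2 nz orth edge_rank.
have [//|ncov] := pselect (int_cover E d).
case: (set_0Vmem E) => [E0|[e eE]].
  by case: ncov; exists (fun=> 0); split=> [e|e f]; rewrite E0 inE.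
(* For this number of colours the edge-rank condition is automatic: the vector of an edge is
   orthogonal to those of the edges disjoint from it. *)
have cover_sub E' : E' \proper E -> int_cover E' (\rank (span E')).
  move=> prop; have sub := subsetP (proper_sub prop).
  apply: IHm => [|f /sub|f /sub|f g /sub fE /sub|x y xyE'].
  - exact: leq_trans (proper_card prop) lt_m.
  - exact: card2.
  - exact: nz.
  - exact: orth.
  apply: leq_trans (rank_span_orth (w := u [set x; y]) _ _) _.
  - by apply: nz; apply: sub.
  - move=> f; rewrite inE => /andP[fE']; rewrite !disjoint_cons => /and3P[xf yf _].
    by apply: orth; rewrite ?sub // disjoint_sym disjoint_set2 xf yf.
  - apply: mxrankS; rewrite addsmx_sub spanS ?avoid_sub // genmxE.
    exact: mem_span.
have /eqP/cards2P[x [y [xy eE']]] := card2 e eE.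
case: (no_path card2 edge_rank cover_sub ncov (s := [:: x; y])) => //=.
  by rewrite -eE' eE.
by rewrite inE xy.
Qed.

End Representation.

(** * Colourings versus orthogonal representations *)

(** Each vertex gets the basis vector of its colour; the ambient dimension bounds the locality. *)
Lemma colorable_orth_rep (K : fieldType) (V : finType) (adj : rel V) k :
    colorable adj k ->
  exists t (u : V -> 'rV[K]_t), orth_rep adj u /\ locality adj u <= k.
Proof.
case/existsP => c /forallP c_adj.
have dotE a b : (dotv (delta_mx 0 (c a)) (delta_mx 0 (c b)) = (c a == c b)%:R :> K)%R.
  rewrite dotvE trmx_delta mul_delta_mx_cond.
  by case: (c a == c b); rewrite ?mulr1n ?mulr0n mxE.
exists k, (fun v => delta_mx 0 (c v))%R; split; last first.
  by apply/bigmax_leqP => v _; apply: rank_leq_col.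
split=> [v | v w _ vw]; first by rewrite dotE eqxx oner_eq0.
by move/forallP: (c_adj v) => /(_ w); rewrite vw dotE => /negbTE->.
Qed.

Section KneserGraph.
Variables (n : nat) (F : {set {set 'I_n}}) (K : fieldType).
Hypothesis card2 : forall A, A \in F -> #|A| = 2.

Lemma orth_rep_colorable t (u : Kvert F -> 'rV[K]_t) :
  orth_rep (@Kadj n F) u -> colorable (@Kadj n F) (locality (@Kadj n F) u).
Proof.
move=> [nz orth]; set d := locality _ _.
pose u' A := if insub A is Some v then u v else 0%R.
have u'E (v : Kvert F) : u' (val v) = u v by rewrite /u' valK.
have in_F A (AF : A \in F) : exists v : Kvert F, val v = A.
  by exists (Sub A AF); rewrite SubK.
have disP (A B : {set 'I_n}) : A \in F -> [disjoint A & B] -> A != B.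
  move=> /card2 cA dis; apply: contraTneq dis => <-.
  by rewrite -setI_eq0 setIid -cards_eq0 cA.
have [c [c_lt c_neq]] : int_cover F d.
  apply: (int_cover_edge_rank (u := u')) => //.
  - by move=> A /in_F[v <-]; rewrite u'E.
  - move=> A B AF /in_F[w wB] dis; have AB := disP _ _ AF dis.
    move: (AF) => /in_F[v vA]; move: AB dis; rewrite -vA -wB !u'E => AB dis.
    have vw : v != w by rewrite -val_eqE.
    by apply: orth; rewrite // /Kadj vw /= setI_eq0.
  - move=> x y /[dup] xyF /in_F[v vxy].
    have avoidP A : A \in avoid F [:: x; y] ->
        exists w, [/\ val w = A, v != w & Kadj v w].
      rewrite inE => /andP[AF]; rewrite !disjoint_cons => /and3P[xA yA _].
      have dis : [disjoint [set x; y] & A] by rewrite disjoint_set2 xA yA.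
      have := disP _ _ xyF dis; move: AF dis => /in_F[w <-].
      rewrite -vxy => dis vw; exists w.
      by rewrite /Kadj -val_eqE vw /= setI_eq0.
    (* Adding [u v], orthogonal to its neighbours' vectors, raises the rank, yet stays in the span
       of the closed neighbourhood of [v]. *)
    apply: leq_trans (rank_span_orth (w := u v) (nz v) _) _.
    + move=> A /avoidP[w [<- vw adj_vw]]; rewrite u'E.
      by rewrite -[RHS](orth v w vw adj_vw); apply: eq_bigr => i _; rewrite mulrC.
    rewrite /d /locality; apply: leq_trans (leq_bigmax v).
    apply: mxrankS; rewrite addsmx_sub; apply/andP; split; last first.
      by apply: (sumsmx_sup v); rewrite ?eqxx.
    apply/spanP => A /avoidP[w [<- vw adj_vw]]; rewrite u'E.
    by apply: (sumsmx_sup w); rewrite ?adj_vw ?orbT ?genmxE.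
apply/existsP; exists [ffun v => Ordinal (c_lt (val v) (valP v))].
apply/forallP => v; apply/forallP => w; apply/implyP => /andP[_ vw].
rewrite !ffunE -val_eqE /=; apply/eqP; apply: c_neq; rewrite ?(valP v) ?(valP w) //.
by rewrite -setI_eq0.
Qed.

End KneserGraph.

Theorem mainTheorem2 (R : realType) (n : nat) (F : {set {set 'I_n}}) :
  (forall A, A \in F -> #|A| = 2) ->
  xi_l_bar R (@Kadj n F) = chiK F.
Proof.
move=> card2; rewrite /xi_l_bar /chiK.
case: ex_minnP => k /asboolP[t [u [u_rep <-]]] k_min.
case: ex_minnP => d d_col d_min; apply/eqP; rewrite eqn_leq.
rewrite (d_min _ (orth_rep_colorable card2 u_rep)) andbT.
have [t' [u' [u'_rep le_d]]] := colorable_orth_rep R d_col.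
apply: leq_trans le_d; apply: k_min; apply/asboolP; by exists t', u'.
Qed.
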